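(* If $p,q\in(2,\infty)$ or $p,q\in(1,2)$, then the range of every contractive projection on the real Banach space $\ell_p(\ell_q)$ has a block basis.
   Context: All Banach spaces are over $\mathbb{R}$. $\ell_p(\ell_q)$ is the Banach space of all functions $x\colon\mathbb{N}\to\ell_q$ with $\|x\|=\big(\sum_{k=1}^\infty\|x(k)\|_q^p\big)^{1/p}<\infty$. Elements $x,y\in\ell_p(\ell_q)$ are disjoint if for every $k\in\mathbb{N}$ the sequences $x(k),y(k)\in\ell_q$ have disjoint supports (with respect to the standard unit vector basis of $\ell_q$). A block basis of a subspace $Y$ is a (Schauder) basis $\{y_i\}_{i=1}^{\dim Y}$ of $Y$ such that $y_i$ and $y_j$ are disjoint for all $i\neq j$. A contractive projection on a Banach space $Z$ is a linear map $P\colon Z\to Z$ with $P^2=P$ and $\|P\|\le1$. *)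

(* Defs.v *)
From HB Require Import structures.
From mathcomp Require Import all_boot all_order all_algebra.
From mathcomp Require Import all_classical all_reals all_analysis.

Set Implicit Arguments.
Unset Strict Implicit.
Unset Printing Implicit Defensive.
Import Order.TTheory GRing.Theory Num.Theory.
Import numFieldNormedType.Exports.

Local Open Scope classical_set_scope.
Local Open Scope ring_scope.

Section ell_enorm.
Context {R : realType} {X : normedModType R} (p : R).
Implicit Types (x y : nat -> X).

Definition ell_enorm x : \bar R :=
  ((\sum_(k <oo) (`|x k| `^ p)%:E) `^ p^-1)%E.

Definition ell_pred : {pred nat -> X} := [pred x | (ell_enorm x < +oo)%E].

Lemma ell_enorm_ge0 x : (0 <= ell_enorm x)%E.
Proof. exact: poweR_ge0. Qed.

Context (p1 : 1 <= p).

Let p0 : 0 < p. Proof. exact: lt_le_trans p1. Qed.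

Let term_ge0 x k : (0 <= (`|x k| `^ p)%:E)%E.
Proof. by rewrite lee_fin powR_ge0. Qed.

Let sum_ge0 x : (0 <= \sum_(k <oo) (`|x k| `^ p)%:E)%E.
Proof. exact: nneseries_ge0. Qed.

Lemma ell_enormE x :
  ell_enorm x = ('N[counting]_p%:E[EFin \o (fun k => `|x k|)%R])%E.
Proof.
rewrite Lnorm_counting//; congr (_ `^ _)%E; apply: eq_eseriesr => k _ /=.
by rewrite normr_id.
Qed.

Lemma le_ell_enorm (Y : normedModType R) x (y : nat -> Y) :
  (forall k, `|x k| <= `|y k|) ->
  (ell_enorm x <= (\sum_(k <oo) (`|y k| `^ p)%:E) `^ p^-1)%E.
Proof.
move=> xy; apply: gt0_ler_poweR; rewrite ?invr_ge0 ?(ltW p0)// ?in_itv/=.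
- by rewrite sum_ge0 leey.
- by rewrite leey andbT; apply: nneseries_ge0 => k _ _; rewrite lee_fin powR_ge0.
- apply: lee_nneseries => [k _ _|k _]; first by rewrite lee_fin powR_ge0.
  by rewrite lee_fin ge0_ler_powR ?nnegrE ?(ltW p0).
Qed.

Lemma ell_enormD x y : (ell_enorm (x + y)%R <= ell_enorm x + ell_enorm y)%E.
Proof.
have mf (f : nat -> R) : measurable_fun setT f by [].
rewrite (ell_enormE x) (ell_enormE y).
apply: le_trans (minkowski_EFin counting (mf _) (mf _) p1).
rewrite Lnorm_counting//.
apply: (@le_ell_enorm R^o (x + y) (fun k => `|x k| + `|y k|)) => k.
by rewrite [leRHS]ger0_norm ?addr_ge0// ler_normD.
Qed.

Lemma ell_enormZ (a : R) x : (ell_enorm (a *: x)%R = `|a|%:E * ell_enorm x)%E.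
Proof.
rewrite /ell_enorm.
under eq_eseriesr do rewrite normrZ powRM// EFinM.
rewrite nneseriesZl// poweRM ?lee_fin ?powR_ge0// poweR_EFin -powRrM.
by rewrite mulfV ?gt_eqF// powRr1.
Qed.

Lemma ell_enorm_coord x k : (`|x k|%:E <= ell_enorm x)%E.
Proof.
have -> : `|x k|%:E = (((`|x k| `^ p)%:E) `^ p^-1)%E.
  by rewrite poweR_EFin -powRrM mulfV ?gt_eqF// powRr1.
apply: gt0_ler_poweR; rewrite ?invr_ge0 ?(ltW p0)// ?in_itv/= ?leey ?andbT//.
apply: le_trans (nneseries_lim_ge k.+1 _) => //.
by rewrite big_nat_recr//= leeDr// sume_ge0.
Qed.

Lemma ell_enorm0 : ell_enorm 0 = 0%E.
Proof.
by rewrite -[X in ell_enorm X](scale0r (0 : nat -> X)) ell_enormZ normr0 mul0e.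
Qed.

Lemma ell_submod_closed : submod_closed ell_pred.
Proof.
split; first by rewrite inE ell_enorm0.
move=> a x y; rewrite !inE => xoo yoo; apply: le_lt_trans (ell_enormD _ _) _.
by rewrite lte_add_pinfty// ell_enormZ lte_mul_pinfty ?lee_fin.
Qed.

End ell_enorm.

(* The proof that [1 <= p] is a parameter of the type because the triangle
   inequality fails for p < 1. *)
Record ell (R : realType) (X : normedModType R) (p : R) (p1 : 1 <= p) := Ell {
  ell_fun :> nat -> X;
  _ : ell_fun \in ell_pred p }.

Section ell_lmodType.
Context {R : realType} (X : normedModType R) (p : R) (p1 : 1 <= p).

HB.instance Definition _ := [isSub of ell X p1 for @ell_fun R X p p1].
HB.instance Definition _ := [Choice of ell X p1 by <:].
HB.instance Definition _ := GRing.isSubmodClosed.Build R (nat -> X)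
  (ell_pred p) (ell_submod_closed p1).
HB.instance Definition _ := [SubChoice_isSubLmodule of ell X p1 by <:].

End ell_lmodType.

Section ell_normedModType.
Context {R : realType} (X : normedModType R) (p : R) (p1 : 1 <= p).
Notation T := (ell X p1).
Implicit Types x y : T.

Definition ell_norm x : R := fine (ell_enorm p x).

Lemma ell_normE x : (ell_norm x)%:E = ell_enorm p x.
Proof. by rewrite fineK// ge0_fin_numE ?ell_enorm_ge0//; exact: valP x. Qed.

Let ell_normD x y : ell_norm (x + y) <= ell_norm x + ell_norm y.
Proof. by rewrite -lee_fin EFinD !ell_normE ell_enormD. Qed.

Let ell_normZ (a : R) x : ell_norm (a *: x) = `|a| * ell_norm x.
Proof. by apply: EFin_inj; rewrite EFinM !ell_normE ell_enormZ. Qed.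

Let ell_norm_eq0 x : ell_norm x = 0 -> x = 0.
Proof.
move=> x0; apply/val_inj/funext => k /=; apply/eqP; rewrite -normr_le0.
by rewrite -lee_fin (le_trans (ell_enorm_coord p1 x k))// -ell_normE x0.
Qed.

Let ell_normMn x n : ell_norm (x *+ n) = ell_norm x *+ n.
Proof. by rewrite -scaler_nat ell_normZ normr_nat mulr_natl. Qed.

Let ell_normN x : ell_norm (- x) = ell_norm x.
Proof. by rewrite -scaleN1r ell_normZ normrN1 mul1r. Qed.

HB.instance Definition _ := Num.Zmodule_isNormed.Build R T
  ell_normD ell_norm_eq0 ell_normMn ell_normN.

Let mdistxx x : `|x - x| = 0. Proof. by rewrite subrr normr0. Qed.

Let mdist_eq0 x y : `|y - x| = 0 -> x = y.
Proof. by move/eqP; rewrite normr_eq0 subr_eq0 => /eqP. Qed.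

Let mdistC x y : `|y - x| = `|x - y|. Proof. exact: distrC. Qed.

Let mdistD y x z : `|z - x| <= `|y - x| + `|z - y|.
Proof. by rewrite [leRHS]addrC ler_distD. Qed.

HB.instance Definition _ := isMetric.Build R T
  mdistxx mdist_eq0 mdistC mdistD.
HB.instance Definition _ := isPointed.Build T 0.
HB.instance Definition _ := NormedZmoduleMetric.Build R T (fun _ _ => erefl).
HB.instance Definition _ :=
  PseudoMetricNormedZmod_Lmodule_isNormedModule.Build R T ell_normZ.

End ell_normedModType.

Section ell_complete.
Context {R : realType} (X : completeNormedModType R) (p : R) (p1 : 1 <= p).
Notation T := (ell X p1).
Implicit Types x : T.

Let p0 : 0 < p. Proof. exact: lt_le_trans p1. Qed.

Let cvg_powR U (F : set_system U) (FF : Filter F) (f : U -> R) (l : R) :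
  (forall u, 0 <= f u) -> 0 <= l -> f @ F --> l ->
  f u `^ p @[u --> F] --> l `^ p.
Proof.
move=> f0; rewrite le_eqVlt => /predU1P[<-|l0] fl.
  rewrite powR0 ?gt_eqF//; apply/cvgr0Pnorm_lt => e e0.
  have e'0 : 0 < e `^ p^-1 by rewrite powR_gt0.
  apply: filterS (cvgr0_norm_lt _ fl _ e'0) => u.
  rewrite !ger0_norm ?powR_ge0// => fu.
  rewrite -[ltRHS](@powRr1 _ e) ?ltW// -(mulVf (lt0r_neq0 p0)) powRrM.
  by rewrite gt0_ltr_powR ?nnegrE// ltW.
have : expR (p * ln (f u)) @[u --> F] --> expR (p * ln l).
  apply: continuous_cvg; first exact: continuous_expR.
  apply: cvgMl_tmp; apply: continuous_cvg fl; exact: continuous_ln.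
rewrite {2}/powR gt_eqF//; apply: cvg_trans; apply: near_eq_cvg.
have : \forall u \near F, 0 < f u by exact: cvgr_gt fl _ _.
by apply: filterS => u fu; rewrite /powR gt_eqF.
Qed.

Let ell_le (u : nat -> X) (e : R) : 0 <= e ->
  (forall n, \sum_(0 <= k < n) `|u k| `^ p <= e `^ p) ->
  (ell_enorm p u <= e%:E)%E.
Proof.
move=> e0 ue.
have -> : e%:E = (((e `^ p)%:E) `^ p^-1)%E.
  by rewrite poweR_EFin -powRrM mulfV ?gt_eqF// powRr1.
apply: gt0_ler_poweR; rewrite ?invr_ge0 ?(ltW p0)// ?in_itv/= ?leey ?andbT.
- by apply: nneseries_ge0 => k _ _; rewrite lee_fin powR_ge0.
- by rewrite lee_fin powR_ge0.
apply: lime_le; first by apply: is_cvg_nneseries => k _ _; rewrite lee_fin powR_ge0.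
by apply: nearW => n; rewrite sumEFin lee_fin.
Qed.

Let le_ell x n : \sum_(0 <= k < n) `|x k| `^ p <= `|x| `^ p.
Proof.
have xE : (`|x|%:E = ell_enorm p x)%E by exact: ell_normE.
have x0 : (0 <= \sum_(k <oo) (`|x k| `^ p)%:E)%E.
  by apply: nneseries_ge0 => k _ _; rewrite lee_fin powR_ge0.
rewrite -lee_fin -poweR_EFin xE /ell_enorm -poweRrM mulVf ?gt_eqF// poweRe1//.
rewrite -sumEFin; apply: nneseries_lim_ge => k _ _.
by rewrite lee_fin powR_ge0.
Qed.

Lemma ell_cauchy_cvg (F : set_system T) : ProperFilter F -> cauchy F -> cvg F.
Proof.
move=> FF /cauchyP Fc.
have cvF k : cvg ((fun x : T => x k) @ F).
  apply: cauchy_cvg; apply: cauchy_exP => e e0; have [x Fx] := Fc e e0.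
  exists (x k); apply: (@filterS _ F _ (ball x e) _ _ Fx) => z; rewrite -!ball_normE /=.
  apply: le_lt_trans; rewrite -lee_fin.
  have -> : `|x - z|%:E = ell_enorm p (x - z) by exact: ell_normE.
  exact: (ell_enorm_coord p1 (x - z) k).
pose y k := lim ((fun x : T => x k) @ F).
have key e x : 0 < e -> F (ball x e) -> (ell_enorm p ((x : nat -> X) - y)%R <= e%:E)%E.
  move=> e0 Fx; apply: ell_le; first exact: ltW.
  move=> n.
  have : \sum_(0 <= k < n) `|x k - z k| `^ p @[z --> F] -->
         \sum_(0 <= k < n) `|x k - y k| `^ p.
    apply: (@cvg_big _ _ +%R); first exact: add_continuous.
    move=> k _; apply: cvg_powR => //.
    by apply: cvg_norm; apply: cvgB; [exact: cvg_cst|exact: cvF].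
  move/cvgr_to_le; apply; apply: (@filterS _ F _ (ball x e) _ _ Fx) => z.
  rewrite -ball_normE /= => xz.
  apply: le_trans (le_ell (x - z) n) _.
  by rewrite ge0_ler_powR ?nnegrE ?normr_ge0 ?(ltW p0) ?(ltW e0) ?(ltW xz).
have yP : y \in ell_pred p.
  have [x Fx] := Fc 1 ltr01; have := key _ _ ltr01 Fx.
  move=> xy; rewrite inE.
  have -> : y = (-1) *: ((x : nat -> X) - y) + (x : nat -> X).
    by rewrite scaleN1r opprB subrK.
  rewrite (le_lt_trans (ell_enormD p1 _ _))// lte_add_pinfty//.
    by rewrite ell_enormZ// lte_mul_pinfty ?lee_fin// (le_lt_trans xy) ?ltry.
  exact: (valP x).
apply/cvg_ex; exists (Ell p1 yP); apply/(@cvgrPdist_le _ _ _ F _ id) => e e0.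
have e20 : 0 < e / 2 by rewrite divr_gt0.
have [x Fx] := Fc _ e20; apply: (@filterS _ F _ (ball x (e / 2)) _ _ Fx) => z.
rewrite -ball_normE /= => xz.
have xy : `|x - Ell p1 yP| <= e / 2 by rewrite -lee_fin ell_normE; exact: key.
by rewrite (le_trans (ler_distD x _ _))// (splitr e) distrC lerD// ltW.
Qed.

HB.instance Definition _ := Uniform_isComplete.Build T ell_cauchy_cvg.

End ell_complete.
Definition contractive_projection (R : realType) (Z : normedModType R)
    (P : {linear Z -> Z}) : Prop :=
  (forall x, P (P x) = P x) /\ (forall x, `|P x| <= `|x|).

(* Indices of a basis of a space of dimension [d]; [None] stands for an
   infinite dimension. *)
Definition basis_index (d : option nat) : set nat :=
  if d is Some n then `I_n else setT.

(* Only the values of [e] on [basis_index d] matter. When [d] is [Some n] the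
   series is eventually constant, so that this is a basis in the algebraic
   sense and [d] is determined by [Y] in all cases. *)
Definition schauder_basis (R : realType) (Z : normedModType R) (Y : set Z)
    (d : option nat) (e : nat -> Z) : Prop :=
  (forall i, basis_index d i -> Y (e i)) /\
  (forall y, Y y -> exists! a : nat -> R,
    (forall i, ~ basis_index d i -> a i = 0) /\
    series (fun i => a i *: e i) @ \oo --> y).

Section block_basis.
Context {R : realType} {p q : R} {p1 : 1 <= p} {q1 : 1 <= q}.
Notation Z := (ell (ell R^o q1) p1).

Definition disjoint_elements (x y : Z) : Prop :=
  forall k, [set j | (x k : ell R^o q1) j != 0] `&`
            [set j | (y k : ell R^o q1) j != 0] = set0.

Definition block_basis (Y : set Z) (d : option nat) (e : nat -> Z) : Prop :=
  schauder_basis Y d e /\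
  (forall i j, basis_index d i -> basis_index d j -> i != j ->
    disjoint_elements (e i) (e j)).

End block_basis.

(* Main.v *)
(** For [x] in the range [Y] of [P] and any [z], contractivity bounds the second
    difference at [x] of the [p]-th power of the norm in the direction [P z] by
    the one in the direction [z]. If both exponents exceed [2], this difference
    is [o(a^2)] along [a z] for [z] a unit vector off the support of [x], but not
    when [z] meets that support, so [P] maps vectors disjoint from [x] to vectors
    disjoint from [x]. If both lie in ]1, 2[, it is [O(a^2)] along the unit
    vectors of the support of [x], but not along vectors with a nonzero entry off
    it, so [P] maps vectors supported there to vectors supported there. In both
    cases strict monotonicity of the norm makes [Y] stable under restriction to
    the support of any of its elements, and the restrictions of [Y] to the
    minimal nonempty supports are lines, which give the block basis. *)

Require Import Defs.
From HB Require Import structures.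
From mathcomp Require Import all_boot all_order all_algebra.
From mathcomp Require Import all_classical all_reals all_analysis.
From mathcomp Require Import ring lra.

Set Implicit Arguments.
Unset Strict Implicit.
Unset Printing Implicit Defensive.
Import Order.TTheory GRing.Theory Num.Theory.
Import numFieldNormedType.Exports.

Local Open Scope classical_set_scope.
Local Open Scope ring_scope.

(** * Tangent lines and sums of powers near a positive number *)

Section tangent.
Context {R : realType}.
Implicit Types (f : R -> R) (a b : R).

Lemma MVT_ball f f1 a e :
  (forall t, `|a - t| < e -> is_derive t 1 f (f1 t)) ->
  forall s t, s < t -> `|a - s| < e -> `|a - t| < e ->
  exists2 c, s < c < t & f t - f s = f1 c * (t - s).
Proof.
move=> df s t st ase ate.
have in_ball c : s <= c <= t -> `|a - c| < e.
  move: ase ate; rewrite !ltr_norml => /andP[? ?] /andP[? ?] /andP[? ?].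
  by apply/andP; split; lra.
have dfs c : c \in `]s, t[ -> is_derive c 1 f (f1 c).
  rewrite in_itv/= => /andP[sc ct]; apply/df/in_ball.
  by rewrite (ltW sc) (ltW ct).
have cf : {within `[s, t], continuous f}.
  apply: derivable_within_continuous => c.
  by rewrite in_itv/= => /in_ball /df -[].
by have [c] := MVT st dfs cf; rewrite in_itv/= => cst fE; exists c.
Qed.

(** Local convexity: [f2 >= 0] makes [f1] nondecreasing near [a], and the mean value theorem then
    compares the slope of the chord from [a] to [t] with [f1 a]. *)
Lemma tangent_le f f1 f2 a :
  nbhs a [set t : R | is_derive t 1 f (f1 t)] ->
  nbhs a [set t : R | is_derive t 1 f1 (f2 t)] ->
  nbhs a [set t : R | 0 <= f2 t] ->
  \forall t \near a, f a + f1 a * (t - a) <= f t.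
Proof.
move=> df df1 f2_ge0.
have /nbhs_ballP[e /= e0 He] :
    nbhs a [set t : R | [/\ is_derive t 1 f (f1 t), is_derive t 1 f1 (f2 t) &
                        0 <= f2 t]].
  by near do split.
have in_e t : `|a - t| < e -> [/\ is_derive t 1 f (f1 t), is_derive t 1 f1 (f2 t) &
                        0 <= f2 t] by exact: He.
have dfe t : `|a - t| < e -> is_derive t 1 f (f1 t) by case/in_e.
have df1e t : `|a - t| < e -> is_derive t 1 f1 (f2 t) by case/in_e.
have ae : `|a - a| < e by rewrite subrr normr0.
have f1_homo s t : `|a - s| < e -> `|a - t| < e -> s < t -> f1 s <= f1 t.
  move=> ase ate st.
  have [c /andP[sc ct] f1E] := MVT_ball df1e st ase ate.
  rewrite -subr_ge0 f1E mulr_ge0 ?subr_ge0 ?(ltW st)//.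
  suff /in_e[] : `|a - c| < e by [].
  move: ase ate.
  by rewrite !ltr_norml => /andP[? ?] /andP[? ?]; apply/andP; split; lra.
exists e => //= t; change (`|a - t| < e -> f a + f1 a * (t - a) <= f t) => ate.
have in_ball c : a < c < t \/ t < c < a -> `|a - c| < e.
  move: ate; rewrite !ltr_norml => /andP[? ?].
  by case=> /andP[? ?]; apply/andP; split; lra.
have [alt|ta|<-] := ltgtP a t; last by rewrite subrr mulr0 addr0.
- have [c act fE] := MVT_ball dfe alt ae ate.
  have : f1 a * (t - a) <= f1 c * (t - a).
    rewrite ler_wpM2r ?subr_ge0 ?(ltW alt)//.
    by apply: f1_homo => //; [apply: in_ball; left|case/andP: act].
  by lra.
- have [c cta fE] := MVT_ball dfe ta ate ae.
  have : f1 c * (a - t) <= f1 a * (a - t).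
    rewrite ler_wpM2r ?subr_ge0 ?(ltW ta)//.
    by apply: f1_homo => //; [apply: in_ball; right|case/andP: cta].
  by lra.
Unshelve. all: by end_near. Qed.

Lemma is_derive_powRB (A B r s t : R) : 0 < t ->
  is_derive t 1 (fun t : R => A * t `^ r - B * t `^ s)
    (A * (r * t `^ (r - 1)) - B * (s * t `^ (s - 1))).
Proof.
move=> t0; have dr z : is_derive t 1 (fun t : R => t `^ z) (z * t `^ (z - 1)).
  exact: is_derive1_powR.
exact: (is_deriveB (is_deriveZ A (dr r)) (is_deriveZ B (dr s))).
Qed.

(* For large [K] the function [K t^r - t^s] is increasing and convex near [a]. *)
Lemma powR_sum_le (r s a : R) : 0 < a -> 1 < r -> 1 < s ->
  exists K e : R, [/\ 0 <= K, 0 < e & forall t u, `|a - t| < e -> `|a - u| < e ->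
    2 * a <= t + u ->
    t `^ s + u `^ s - 2 * a `^ s <= K * (t `^ r + u `^ r - 2 * a `^ r)].
Proof.
move=> a0 r1 s1.
(* The two quotients are the values of [K] at which the second and the first derivative of
   [K t^r - t^s] vanish at [a]. The [1] makes the second derivative strictly positive at [a], so
   that its sign persists nearby. *)
pose K : R := `|s * (s - 1) * a `^ (s - 1 - 1) / (r * (r - 1) * a `^ (r - 1 - 1))| + 1
   + `|s * a `^ (s - 1) / (r * a `^ (r - 1))|.
have K0 : 0 <= K by rewrite /K !addr_ge0.
pose f (t : R) : R := K * t `^ r - 1 * t `^ s.
pose f1 (t : R) : R := K * r * t `^ (r - 1) - s * t `^ (s - 1).
pose f2 (t : R) : R := K * r * ((r - 1) * t `^ (r - 1 - 1)) - s * ((s - 1) * t `^ (s - 1 - 1)).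
have df (t : R) : 0 < t -> is_derive t 1 f (f1 t).
  move=> t0; have := is_derive_powRB K 1 r s t0.
  by rewrite mul1r mulrA.
have df1 (t : R) : 0 < t -> is_derive t 1 f1 (f2 t).
  exact: is_derive_powRB.
have pos : \forall t \near a, 0 < t by exact: lt_nbhsr.
have f1a : 0 <= f1 a.
  rewrite /f1 subr_ge0 -mulrA -ler_pdivrMr; last first.
    by rewrite mulr_gt0 ?powR_gt0//; lra.
  by rewrite (le_trans (ler_norm _))// /K lerDr addr_ge0.
have f2a : 0 < f2 a.
  have -> : f2 a = K * (r * (r - 1) * a `^ (r - 1 - 1)) - s * (s - 1) * a `^ (s - 1 - 1).
    by rewrite /f2; ring.
  rewrite subr_gt0 -ltr_pdivrMr; last first.
    by rewrite !mulr_gt0 ?powR_gt0//; lra.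
  rewrite (le_lt_trans (ler_norm _))// /K.
  by apply: (lt_le_trans (ltr_pwDr ltr01 (lexx _))); rewrite lerDl.
have f2_ge0 : \forall t \near a, 0 <= f2 t.
  have : {for a, continuous f2}.
    have cpow z : {for a, continuous (fun t : R => t `^ z)}.
      apply: differentiable_continuous; apply/derivable1_diffP.
      by apply: derivable_powR; rewrite in_itv/= a0.
    apply: continuousB; repeat (apply: continuousM; first exact: cst_continuous);
    exact: cpow.
  move=> /(cvgr_gt (f2 a))/(_ 0 f2a); apply: filterS => t; exact: ltW.
have [e /= e0 He] := tangent_le (filterS df pos) (filterS df1 pos) f2_ge0.
exists K, e; split=> // t u ate aue tu.
have ft : f a + f1 a * (t - a) <= f t by exact: He.
have fu : f a + f1 a * (u - a) <= f u by exact: He.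
rewrite -subr_ge0 [leRHS](_ : _ = f t + f u - 2 * f a); last by rewrite /f; ring.
(* Adding the tangent bounds at [t] and [u] leaves this term. *)
have : 0 <= f1 a * (t + u - 2 * a) by rewrite mulr_ge0// subr_ge0.
by lra.
Unshelve. all: by end_near. Qed.

End tangent.

(** * Second differences of powers of a norm *)

Definition second_diff (R : realType) (X : normedModType R) (r : R) (u v : X) : R :=
  `|u + v| `^ r + `|u - v| `^ r - 2 * `|u| `^ r.

Section second_diff.
Context {R : realType} {X : normedModType R}.
Implicit Types (r s : R) (u v : X).

(** [u] is the midpoint of [u + v] and [u - v], and the [r]-th power of the norm is convex. *)
Lemma second_diff_ge0 r u v : 1 <= r -> 0 <= second_diff r u v.
Proof.
move=> r1; have r0 : 0 <= r by apply: le_trans r1.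
rewrite subr_ge0 mulrC -ler_pdivlMr//.
have uE : u = 2^-1 *: (u + v) + 2^-1 *: (u - v).
  rewrite -scalerDr addrACA subrr addr0 scalerDr -scalerDl -[LHS]scale1r.
  by congr (_ *: _); lra.
have ule : `|u| <= 2^-1 * `|u + v| + 2^-1 * `|u - v|.
  by rewrite {1}uE (le_trans (ler_normD _ _))// !normrZ ger0_norm.
apply: le_trans (ge0_ler_powR r0 _ _ ule) _.
- by rewrite nnegrE.
- by rewrite nnegrE addr_ge0// mulr_ge0.
rewrite {2}(_ : 2^-1 = 1 - 2^-1); last by lra.
rewrite [leRHS](_ : _ = 2^-1 * `|u + v| `^ r + (1 - 2^-1) * `|u - v| `^ r); last by lra.
apply: (convex_powR r1 (Itv01 _ _)) => //=;
  rewrite ?inE/= ?in_itv/= ?normr_ge0// ?invr_ge0// invf_le1 ?ler1n//.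
Qed.

(** Since [f] fixes [u], the vectors [u + f v] and [u - f v] are the images of [u + v] and
    [u - v]. *)
Lemma second_diff_contraction r (f : {linear X -> X}) u v :
  0 <= r -> (forall w, `|f w| <= `|w|) -> f u = u ->
  second_diff r u (f v) <= second_diff r u v.
Proof.
move=> r0 f1 fu; rewrite lerB// lerD// ge0_ler_powR ?nnegrE//.
- by rewrite -[in leLHS]fu -linearD.
- by rewrite -[in leLHS]fu -linearB.
Qed.

Lemma second_diff0l r v : 0 < r -> second_diff r 0 v = 2 * `|v| `^ r.
Proof.
move=> r0.
by rewrite /second_diff add0r sub0r normrN normr0 powR0 ?gt_eqF// mulr0 subr0 mulr_natl.
Qed.

Lemma second_diff0r r u : second_diff r u 0 = 0.
Proof. by rewrite /second_diff addr0 subr0 -mulr2n mulr_natl subrr. Qed.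

Lemma second_diff0lZ r (a : R) v : 0 < r -> 0 <= a ->
  second_diff r 0 (a *: v) = 2 * `|v| `^ r * a `^ r.
Proof.
by move=> r0 a0; rewrite second_diff0l// normrZ ger0_norm// powRM// mulrAC mulrA.
Qed.

(** The parallelogram identity. For scalars and exponent [2] the base point drops out, which makes
    the order [a^2] explicit. *)
Lemma second_diff2 (u v : R^o) : second_diff 2 u v = 2 * v ^+ 2.
Proof.
rewrite /second_diff !powR_mulrn// !real_normK ?num_real//; ring.
Qed.

End second_diff.

(* [f = O(g)] as the argument decreases to [0], without absolute values. *)
Definition dominated (R : realType) (f g : R -> R) : Prop :=
  exists2 K, 0 <= K & \forall a \near 0^'+, f a <= K * g a.

(** * Orders of growth of second differences at zero *)

Section dominated.
Context {R : realType}.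
Implicit Types f g h : R -> R.

Lemma dominated_trans g f h : dominated f g -> dominated g h -> dominated f h.
Proof.
move=> [K K0 fg] [L L0 gh]; exists (K * L); first exact: mulr_ge0.
near=> a; apply: (@le_trans _ _ (K * g a)); first by near: a.
by rewrite -mulrA ler_wpM2l//; near: a.
Unshelve. all: by end_near. Qed.

Lemma le_dominated f g : (forall a, 0 < a -> f a <= g a) -> dominated f g.
Proof.
move=> fg; exists 1 => //; near=> a; rewrite mul1r; apply: fg.
by near: a; exact: nbhs_right_gt.
Unshelve. all: by end_near. Qed.

Lemma dominated_powR f (K s : R) : 0 <= K ->
  (forall a, 0 < a -> f a = K * a `^ s) -> dominated f (fun a => a `^ s).
Proof.
move=> K0 fE; exists K => //; near=> a.
have a0 : 0 < a by near: a; exact: nbhs_right_gt.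
by rewrite fE.
Unshelve. all: by end_near. Qed.

(** Dividing by [a^s] bounds [c] by [K a^(t - s)], which tends to [0]. This is how entries of image
    vectors are shown to vanish. *)
Lemma dominated_powR_eq0 (c s t : R) : s < t -> 0 <= c ->
  dominated (fun a => c * a `^ s) (fun a => a `^ t) -> c = 0.
Proof.
move=> st c0 [K K0 cK]; apply/eqP; rewrite eq_le c0 andbT.
have : K * a `^ (t - s) @[a --> 0^'+] --> K * 0.
  by apply: cvgMl_tmp; apply: powR_cvg0; rewrite subr_gt0.
rewrite mulr0 => /(cvgr_to_ge (b := c)); apply; near=> a.
have a0 : 0 < a by near: a; exact: nbhs_right_gt.
rewrite -(ler_pM2r (powR_gt0 s a0)) -mulrA -powRD ?subrK ?(gt_eqF a0) ?implybT//.
by near: a.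
Unshelve. all: by end_near. Qed.

(** [powR_sum_le] at the norm of [u], applied to the norms of [u + a v] and [u - a v]. At a nonzero
    base point the exponents [p], [q] and [2] thus become interchangeable up to a constant. *)
Lemma second_diff_dominated (X : normedModType R) (r s : R) (u v : X) :
  u != 0 -> 1 < r -> 1 < s ->
  dominated (fun a => second_diff s u (a *: v)) (fun a => second_diff r u (a *: v)).
Proof.
move=> u0 r1 s1; have nu : 0 < `|u| by rewrite normr_gt0.
have [K [e [K0 e0 Ke]]] := powR_sum_le nu r1 s1; exists K => //.
near=> a.
have a0 : 0 < a by near: a; exact: nbhs_right_gt.
have ave : a * `|v| < e.
  (* Adding [1] avoids a division by zero when [v = 0]. *)
  rewrite (@le_lt_trans _ _ (a * (`|v| + 1)))//.
    by rewrite ler_wpM2l ?lerDl// ltW.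
  rewrite -ltr_pdivlMr ?ltr_wpDl//.
  by near: a; apply: nbhs_right_lt; rewrite divr_gt0// ltr_wpDl.
apply: Ke.
- rewrite (le_lt_trans (ler_dist_dist _ _))// opprD addrA subrr sub0r normrN.
  by rewrite normrZ gtr0_norm.
- rewrite (le_lt_trans (ler_dist_dist _ _))// opprB addrC subrK.
  by rewrite normrZ gtr0_norm.
- rewrite mulr_natl -normrMn; apply: le_trans (ler_normD _ _).
  by rewrite addrACA subrr addr0 -mulr2n.
Unshelve. all: by end_near. Qed.

End dominated.

(** * Norms, second differences and tails in [ell X p1] *)

Lemma series_le_lim (R : realType) (u : nat -> R) (l : R) n :
  (forall k, 0 <= u k) -> series u @ \oo --> l -> series u n <= l.
Proof.
move=> u0 ul; rewrite -(cvg_lim _ ul)//; apply: nondecreasing_cvgn_le.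
- by apply: nondecreasing_series => k _ _; exact: u0.
- by apply/cvg_ex; exists l.
Qed.

Lemma term_le_lim (R : realType) (u : nat -> R) (l : R) k :
  (forall k, 0 <= u k) -> series u @ \oo --> l -> u k <= l.
Proof.
move=> u0 /(series_le_lim k.+1 u0); apply: le_trans.
by rewrite /series/= big_nat_recr//= lerDr sumr_ge0.
Qed.

Section ell.
Context {R : realType} {X : normedModType R} {p : R} {p1 : 1 <= p}.
Notation T := (ell X p1).
Implicit Types x y w : T.

Let p0 : 0 < p. Proof. exact: lt_le_trans p1. Qed.

Lemma ell_eqP x y : (forall k, x k = y k) -> x = y.
Proof. by move=> xy; apply/val_inj/funext. Qed.

Lemma ellD x y k : (x + y) k = x k + y k. Proof. reflexivity. Qed.
Lemma ellN x k : (- x) k = - x k. Proof. reflexivity. Qed.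
Lemma ell0 k : (0 : T) k = 0. Proof. reflexivity. Qed.
Lemma ellZ a x k : (a *: x) k = a *: x k. Proof. reflexivity. Qed.

Lemma series_ell x : series (fun k => `|x k| `^ p) @ \oo --> `|x| `^ p.
Proof.
have xE : (\sum_(k <oo) (`|x k| `^ p)%:E)%E = (`|x| `^ p)%:E.
  rewrite -poweR_EFin [`|x|%:E](ell_normE x) /ell_enorm -poweRrM mulVf ?gt_eqF//.
  by rewrite poweRe1// nneseries_ge0// => k _ _; rewrite lee_fin powR_ge0.
have : (\sum_(0 <= k < n) (`|x k| `^ p)%:E)%E @[n --> \oo] --> (`|x| `^ p)%:E.
  by rewrite -xE; apply: is_cvg_nneseries => k _ _; rewrite lee_fin powR_ge0.
rewrite (_ : (fun n => _) = EFin \o series (fun k => `|x k| `^ p)).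
  by move/fine_cvg.
by apply/funext => n; rewrite sumEFin.
Qed.

Lemma ell_pred_le x (y : nat -> X) : (forall k, `|y k| <= `|x k|) -> y \in ell_pred p.
Proof.
move=> yx; rewrite inE; apply: le_lt_trans (le_ell_enorm p1 yx) _.
exact: (valP x).
Qed.

Lemma ell_coord_le x k : `|x k| <= `|x|.
Proof. by rewrite -lee_fin [`|x|%:E](ell_normE x); exact: ell_enorm_coord. Qed.

Lemma ell_norm_le x y : (forall k, `|x k| <= `|y k|) -> `|x| <= `|y|.
Proof.
move=> xy; rewrite -lee_fin [`|x|%:E](ell_normE x) [`|y|%:E](ell_normE y).
exact: le_ell_enorm.
Qed.

(** Strict monotonicity of the norm: the gaps between the [p]-th powers of the entries are
    nonnegative and their sum, the gap between those of the norms, is zero. *)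
Lemma ell_norm_eq x y : (forall k, `|x k| <= `|y k|) -> `|y| <= `|x| ->
  forall k, `|x k| = `|y k|.
Proof.
move=> xy yx k; apply/eqP; rewrite eq_le xy/=.
have le_pow j : `|x j| `^ p <= `|y j| `^ p by rewrite ge0_ler_powR ?nnegrE// ltW.
have : `|y k| `^ p - `|x k| `^ p <= `|y| `^ p - `|x| `^ p.
  apply: (@term_le_lim _ (fun k => `|y k| `^ p - `|x k| `^ p)) => [j|].
    by rewrite subr_ge0.
  rewrite (_ : series _ = series (fun k => `|y k| `^ p) - series (fun k => `|x k| `^ p)).
    by apply: cvgB; exact: series_ell.
  by apply/funext => n; rewrite /series/= sumrB.
have -> : `|x| = `|y| by apply/eqP; rewrite eq_le yx ell_norm_le.
rewrite subrr subr_le0 leNgt => yxk; rewrite leNgt; apply: contra yxk => yxk.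
by rewrite gt0_ltr_powR ?nnegrE.
Qed.

Lemma series_second_diff x w :
  series (fun k => second_diff p (x k) (w k)) @ \oo --> second_diff p x w.
Proof.
pose s y := series (fun k => `|y k| `^ p).
rewrite (_ : series _ = s (x + w) + s (x - w) - (fun n => 2 * s x n)).
  apply: cvgB; last by apply: cvgMl_tmp; exact: series_ell.
  by apply: cvgD; exact: series_ell.
by apply/funext => n; rewrite /s /series/= !fctE mulr_sumr -big_split -sumrB.
Qed.

(** Second differences of exponent [p] add up over the coordinates, and by convexity no coordinate
    contributes negatively. *)
Lemma second_diff_coord x w k : second_diff p (x k) (w k) <= second_diff p x w.
Proof.
by apply: term_le_lim (@series_second_diff x w) => j; exact: second_diff_ge0.
Qed.

Lemma second_diff_single x w l : (forall k, k != l -> w k = 0) ->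
  second_diff p x w = second_diff p (x l) (w l).
Proof.
move=> w0; apply: (cvg_unique _ (@series_second_diff x w)) => //.
apply: cvg_near_cst; exists l.+1 => // n /= ln.
rewrite /series/= (bigD1_seq l) ?mem_index_iota ?iota_uniq//=.
rewrite big1 ?addr0// => k kl; by rewrite w0// second_diff0r.
Qed.

Lemma ell_norm_single x l : (forall k, k != l -> x k = 0) -> `|x| = `|x l|.
Proof.
move=> x0; have := second_diff_single 0 x0; rewrite !second_diff0l//.
have two0 : 2 != 0 :> R by rewrite pnatr_eq0.
by move/(mulfI two0)/(powR_injective p0); apply; rewrite nnegrE.
Qed.

Lemma ell_norm_tail x e : 0 < e -> exists N, forall y,
  (forall k, (k < N)%N -> y k = 0) -> (forall k, `|y k| <= `|x k|) -> `|y| <= e.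
Proof.
move=> e0; have ep0 : 0 < e `^ p by rewrite powR_gt0.
have /cvgrPdist_le/(_ _ ep0)[N _ HN] := @series_ell x.
exists N => y y0 yx.
rewrite leNgt; apply/negP => ey.
have := HN N (leqnn _); rewrite /= leNgt => /negP; apply.
apply: lt_le_trans (ler_norm _).
have : e `^ p < `|y| `^ p by rewrite gt0_ltr_powR ?nnegrE ?(ltW e0).
move=> /lt_le_trans; apply.
rewrite lerBrDr addrC -lerBrDr.
(* As [y] vanishes before [N], subtracting its terms does not change this partial sum, while the
   full series of differences sums to [|x|^p - |y|^p]. *)
have -> : series (fun k => `|x k| `^ p) N = series (fun k => `|x k| `^ p - `|y k| `^ p) N.
  rewrite /series/=; apply: eq_big_nat => k /andP[_ kN].
  by rewrite y0// normr0 powR0 ?subr0// gt_eqF.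
apply: series_le_lim => [k|].
  by rewrite subr_ge0 ge0_ler_powR ?nnegrE// ltW.
rewrite (_ : series _ = series (fun k => `|x k| `^ p) - series (fun k => `|y k| `^ p)).
  by apply: cvgB; exact: series_ell.
by apply/funext => n; rewrite /series/= sumrB.
Qed.

End ell.

(** * Coordinates, restrictions to sets of coordinates, and closed subspaces *)

Section restrict.
Context {R : realType} {p q : R} {p1 : 1 <= p} {q1 : 1 <= q}.
Notation X := (ell R^o q1).
Notation Z := (ell X p1).
Implicit Types (x y z : Z) (A B : set (nat * nat)).

Definition coord z (t : nat * nat) : R := (z t.1 : X) t.2.

Lemma coordD x y t : coord (x + y) t = coord x t + coord y t.
Proof. by rewrite /coord !ellD. Qed.

Lemma coordB x y t : coord (x - y) t = coord x t - coord y t.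
Proof. by rewrite /coord !(ellD, ellN). Qed.

Lemma coordZ a x t : coord (a *: x) t = a * coord x t.
Proof. by rewrite /coord !ellZ. Qed.

Lemma coord0 t : coord 0 t = 0.
Proof. by rewrite /coord !ell0. Qed.

Lemma coord_sum (I : Type) (r : seq I) (P : pred I) (F : I -> Z) t :
  coord (\sum_(i <- r | P i) F i) t = \sum_(i <- r | P i) coord (F i) t.
Proof. exact: (big_morph (coord^~ t) (fun x y => coordD x y t) (coord0 t)). Qed.

Lemma coord_eqP x y : coord x =1 coord y -> x = y.
Proof.
by move=> xy; apply: ell_eqP => k; apply: ell_eqP => j; exact: (xy (k, j)).
Qed.

Lemma coord_norm_le x y : (forall t, `|coord x t| <= `|coord y t|) -> `|x| <= `|y|.
Proof.
by move=> xy; apply: ell_norm_le => k; apply: ell_norm_le => j; exact: (xy (k, j)).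
Qed.

(** Strict monotonicity is used twice: on the outer level it equates the norms of the rows, and
    within each row the entries. *)
Lemma coord_norm_eq x y : (forall t, `|coord x t| <= `|coord y t|) ->
  `|y| <= `|x| -> forall t, `|coord x t| = `|coord y t|.
Proof.
move=> xy yx [k j]; apply: (@ell_norm_eq _ _ _ q1 (x k) (y k)) => [i|].
  exact: (xy (k, i)).
rewrite (@ell_norm_eq _ _ _ _ x y) => // i.
by apply: ell_norm_le => i'; exact: (xy (i, i')).
Qed.

Lemma row_restrict_subproof (A : set nat) (v : X) :
  (fun j => if j \in A then v j else 0) \in ell_pred q.
Proof.
by apply: (ell_pred_le (x := v)) => j; case: ifP => // _; rewrite normr0.
Qed.

Definition row_restrict (A : set nat) (v : X) : X :=
  Ell q1 (row_restrict_subproof A v).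

Lemma restrict_subproof A z :
  (fun k => row_restrict [set j | A (k, j)] (z k)) \in ell_pred p.
Proof.
apply: (ell_pred_le (x := z)) => k; apply: ell_norm_le => j /=.
by case: ifP => // _; rewrite normr0.
Qed.

Definition restrict A z : Z := Ell p1 (restrict_subproof A z).

Lemma restrictE A z k j :
  restrict A z k j = if (k, j) \in A then z k j else 0.
Proof. reflexivity. Qed.

Lemma coord_restrict A z t :
  coord (restrict A z) t = if t \in A then coord z t else 0.
Proof. by case: t => k j. Qed.

Lemma restrict_norm_le A z : `|restrict A z| <= `|z|.
Proof.
apply: coord_norm_le => t; rewrite coord_restrict.
by case: ifP => // _; rewrite normr0.
Qed.

Lemma coord_le_norm z t : `|coord z t| <= `|z|.
Proof.
exact: le_trans (ell_coord_le (z t.1) t.2) (ell_coord_le z t.1).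
Qed.

Lemma restrict_sum_setC A z : restrict A z + restrict (~` A) z = z.
Proof.
apply: coord_eqP => t; rewrite coordD !coord_restrict in_setC.
by case: ifP; rewrite ?addr0 ?add0r.
Qed.

Lemma restrict_restrict A B z : restrict A (restrict B z) = restrict (A `&` B) z.
Proof.
apply: coord_eqP => t; rewrite !coord_restrict in_setI.
by case: (t \in A).
Qed.

Lemma restrict_sub_norm_le A B z : A `<=` B -> `|restrict A z| <= `|restrict B z|.
Proof.
by move=> /setIidPl<-; rewrite -restrict_restrict restrict_norm_le.
Qed.

Lemma restrict_setU_norm_le A B z :
  `|restrict (A `|` B) z| <= `|restrict A z| + `|restrict B z|.
Proof.
rewrite -[X in `|X|](restrict_sum_setC A) !restrict_restrict.
apply: le_trans (ler_normD _ _) _.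
apply: lerD; apply: restrict_sub_norm_le => t []//.
by move=> ? [].
Qed.

Lemma restrict_row_tail k z e : 0 < e ->
  exists M, `|restrict [set t | t.1 = k /\ (M <= t.2)%N] z| <= e.
Proof.
move=> e0; have [M HM] := ell_norm_tail (z k) e0; exists M.
rewrite (@ell_norm_single _ _ _ _ _ k); last first.
  move=> l lk; apply: ell_eqP => j; rewrite restrictE.
  by rewrite ifF//; apply/negP; rewrite inE => -[/= /eqP]; rewrite (negbTE lk).
apply: HM => j; rewrite restrictE.
  by move=> jM; rewrite ifF//; apply/negP; rewrite inE /= leqNgt jM => -[].
by case: ifP => // _; rewrite normr0.
Qed.

Lemma restrict_rows_tail N z e : 0 < e ->
  exists M, `|restrict [set t | (t.1 < N)%N /\ (M <= t.2)%N] z| <= e.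
Proof.
elim: N e => [|N IH] e e0.
  exists 0%N; rewrite (_ : restrict _ z = 0) ?normr0 ?ltW//.
  apply: coord_eqP => t; rewrite coord_restrict ifF//.
  by apply/negP; rewrite inE => -[].
have e20 : 0 < e / 2 by rewrite divr_gt0.
have [M1 H1] := IH _ e20; have [M2 H2] := restrict_row_tail N z e20.
exists (maxn M1 M2); rewrite (splitr e).
apply: le_trans (lerD H1 H2); apply: le_trans (restrict_setU_norm_le _ _ _).
apply: restrict_sub_norm_le => -[k j] /= []; rewrite geq_max ltnS leq_eqVlt.
by move=> /predU1P[->|kN] /andP[M1j M2j]; [right|left].
Qed.

(** Cutting the rows from [N] on and then the entries from [M] on in the remaining rows costs
    [e / 2] each. Arguments about single coordinates reach arbitrary sets through this
    approximation. *)
Lemma restrict_setC_finite z e : 0 < e ->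
  exists l : seq (nat * nat), `|restrict (~` [set` l]) z| <= e.
Proof.
move=> e0; have e20 : 0 < e / 2 by rewrite divr_gt0.
have [N HN] := ell_norm_tail z e20.
have [M HM] := restrict_rows_tail N z e20.
exists [seq (k, j) | k <- iota 0 N, j <- iota 0 M].
have {}HN : `|restrict [set t | (N <= t.1)%N] z| <= e / 2.
  apply: HN => k; last first.
    apply: ell_norm_le => j; rewrite restrictE.
    by case: ifP => // _; rewrite normr0.
  move=> kN; apply: ell_eqP => j; rewrite restrictE.
  by rewrite ifF//; apply/negP; rewrite inE /= leqNgt kN.
rewrite (splitr e); apply: le_trans (lerD HN HM).
apply: le_trans (restrict_setU_norm_le _ _ _).
apply: restrict_sub_norm_le => -[k j] /= /negP kj.
have [|kN] := leqP N k; [by left|right; split=> //].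
rewrite leqNgt; apply: contra kj => jM.
by apply: allpairs_f; rewrite mem_iota.
Qed.

(** The empty set also qualifies, whence the separate hypothesis [W 0] in
    [closed_subspace_restrict]. *)
Definition closed_subspace (W : set Z) : Prop :=
  [/\ forall a x y, W x -> W y -> W (a *: x + y) &
      forall z, (forall e, 0 < e -> exists2 z', W z' & `|z - z'| <= e) -> W z].

Lemma closed_subspace0 W x : closed_subspace W -> W x -> W 0.
Proof.
by move=> [lin _] Wx; have := lin (-1) _ _ Wx Wx; rewrite scaleN1r addNr.
Qed.

Lemma closed_subspaceD W x y : closed_subspace W -> W x -> W y -> W (x + y).
Proof. by move=> [lin _] Wx Wy; have := lin 1 _ _ Wx Wy; rewrite scale1r. Qed.

Lemma closed_subspaceZ W a x : closed_subspace W -> W x -> W (a *: x).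
Proof.
move=> cW Wx; case: (cW) => lin _.
by have := lin a _ _ Wx (closed_subspace0 cW Wx); rewrite addr0.
Qed.

Lemma closed_subspaceB W x y : closed_subspace W -> W x -> W y -> W (x - y).
Proof.
by move=> cW Wx Wy; rewrite -scaleN1r; apply: closed_subspaceD => //; exact: closed_subspaceZ.
Qed.

(** Finite parts of [A] are added up one coordinate at a time, and closedness gives the limit. *)
Lemma closed_subspace_restrict W A z : closed_subspace W -> W 0 ->
  (forall t, A t -> W (restrict [set t] z)) -> W (restrict A z).
Proof.
move=> cW W0 WA.
have Wl (l : seq (nat * nat)) : W (restrict (A `&` [set` l]) z).
  elim: l => [|t l IH].
    rewrite (_ : restrict _ z = 0)//.
    apply: coord_eqP => t; rewrite coord_restrict ifF//.
    by apply/negP; rewrite inE => -[].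
  have [/andP[tA tl]|tAl] := boolP ((t \in A) && (t \notin l)).
    rewrite (_ : restrict _ z = restrict [set t] z + restrict (A `&` [set` l]) z).
      apply: closed_subspaceD => //; apply: WA; exact: set_mem.
    apply: coord_eqP => s; rewrite coordD !coord_restrict !in_setI !mem_setE in_set1 in_cons.
    have [->|st] := eqVneq s t; last by rewrite add0r.
    by rewrite tA (negbTE tl) addr0.
  rewrite (_ : A `&` _ = A `&` [set` l])//.
  apply/seteqP; split=> s [As]/=; rewrite !inE => sl; split=> //=.
    move/predU1P : sl => [st|//]; move: tAl; rewrite -st negb_and negbK.
    by rewrite (mem_set As).
  by rewrite sl orbT.
case: cW => _; apply => e /(restrict_setC_finite z)[l le].
exists (restrict (A `&` [set` l]) z); first exact: Wl.
rewrite (_ : _ - _ = restrict A (restrict (~` [set` l]) z)).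
  exact: le_trans (restrict_norm_le _ _) le.
apply: coord_eqP => t; rewrite coordB !coord_restrict in_setI in_setC.
by case: (t \in A); case: (t \in _); rewrite /= ?subr0 ?subrr.
Qed.

End restrict.

(** * Ranges of contractive projections are stable under restriction to supports *)

Section contractive.
Context {R : realType} {p q : R} {p1 : 1 <= p} {q1 : 1 <= q}.
Notation X := (ell R^o q1).
Notation Z := (ell X p1).
Implicit Types (x y z w : Z) (s t : nat * nat).

Let p0 : 0 < p. Proof. exact: lt_le_trans p1. Qed.
Let q0 : 0 < q. Proof. exact: lt_le_trans q1. Qed.

Definition support x : set (nat * nat) := [set t | coord x t != 0].

Lemma restrict1_row t y k : k != t.1 -> restrict [set t] y k = 0.
Proof.
move=> kt; apply: ell_eqP => j.
rewrite restrictE in_set1 ifF//.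
by apply/negbTE; apply: contra kt => /eqP<-.
Qed.

Lemma restrict1_coord t y i : i != t.2 -> restrict [set t] y t.1 i = 0.
Proof.
move=> it; case: t it => k j it; rewrite restrictE in_set1 ifF//.
by apply/negbTE; apply: contra it => /eqP<-.
Qed.

Lemma second_diff_restrict1 x y t (a : R) :
  second_diff p x (a *: restrict [set t] y) =
  second_diff p (x t.1) (a *: restrict [set t] y t.1).
Proof.
rewrite (@second_diff_single _ _ _ _ _ _ t.1) ?ellZ// => k kt.
by rewrite ellZ restrict1_row// scaler0.
Qed.

Lemma second_diff_restrict1_coord x y t (a : R) :
  second_diff q (x t.1) (a *: restrict [set t] y t.1) =
  second_diff q (coord x t : R^o) (a *: (coord y t : R^o)).
Proof.
rewrite (@second_diff_single _ _ _ _ _ _ t.2) ?ellZ; last first.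
  by move=> i it; rewrite ellZ restrict1_coord// scaler0.
by case: t => k j; rewrite restrictE in_set1 eqxx.
Qed.

(** Only the row [t.1], and in it only the entry [t.2], is perturbed. Between these two reductions
    the exponent changes from [p] to [q], which needs the row of [x] to be nonzero. *)
Lemma dominated_restrict1 x y t : 1 < p -> 1 < q -> x t.1 != 0 ->
  dominated (fun a => second_diff p x (a *: restrict [set t] y))
    (fun a => second_diff q (coord x t : R^o) (a *: (coord y t : R^o))).
Proof.
move=> p_gt1 q_gt1 xt.
apply: (@dominated_trans _ (fun a => second_diff p (x t.1) (a *: restrict [set t] y t.1))).
  by apply: le_dominated => a _; rewrite second_diff_restrict1.
apply: (@dominated_trans _ (fun a => second_diff q (x t.1) (a *: restrict [set t] y t.1))).
  exact: second_diff_dominated.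
by apply: le_dominated => a _; rewrite second_diff_restrict1_coord.
Qed.

(** At a zero row exponents cannot be exchanged, but the second difference is an exact multiple of
    [a^p]. *)
Lemma dominated_restrict1_row0 x y t : x t.1 = 0 ->
  dominated (fun a => second_diff p x (a *: restrict [set t] y)) (fun a => a `^ p).
Proof.
move=> xt; apply: (@dominated_powR _ _ (2 * `|restrict [set t] y t.1| `^ p)).
  by rewrite mulr_ge0// powR_ge0.
by move=> a a0; rewrite second_diff_restrict1 xt second_diff0lZ// ltW.
Qed.

Lemma second_diff_row_le x w k (a : R) :
  second_diff p (x k) (a *: w k) <= second_diff p x (a *: w).
Proof. by have := second_diff_coord x (a *: w) k; rewrite ellZ. Qed.

(** A lower bound for any direction [w]: by nonnegativity the other rows and entries can be
    discarded, with the exponent changed in between. *)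
Lemma dominated_coord x w s : 1 < p -> 1 < q -> x s.1 != 0 ->
  dominated (fun a => second_diff q (coord x s : R^o) (a *: (coord w s : R^o)))
    (fun a => second_diff p x (a *: w)).
Proof.
move=> p_gt1 q_gt1 xs.
apply: (@dominated_trans _ (fun a => second_diff q (x s.1) (a *: w s.1))).
  by apply: le_dominated => a _; have := second_diff_coord (x s.1) (a *: w s.1) s.2; rewrite ellZ.
apply: (@dominated_trans _ (fun a => second_diff p (x s.1) (a *: w s.1))).
  exact: second_diff_dominated.
by apply: le_dominated => a _; exact: second_diff_row_le.
Qed.

Context (P : {linear Z -> Z}) (Pproj : contractive_projection P).

Lemma contractive_second_diff x z (a : R) : P x = x ->
  second_diff p x (a *: P z) <= second_diff p x (a *: z).
Proof.
move=> Px; have [_ Pc] := Pproj; rewrite -linearZ.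
exact: second_diff_contraction (ltW p0) Pc Px.
Qed.

Lemma disjoint_image1 x y t s : 2 < p -> 2 < q -> P x = x ->
  coord x t = 0 -> coord x s != 0 -> coord (P (restrict [set t] y)) s = 0.
Proof.
move=> p2 q2 Px xt xs; set z := restrict _ _; set w := P z.
have p_gt1 : 1 < p by apply: lt_trans p2; rewrite ltr1n.
have q_gt1 : 1 < q by apply: lt_trans q2; rewrite ltr1n.
have xs0 : x s.1 != 0.
  by apply: contra_neq xs => xs; rewrite /coord xs ell0.
(* At the nonzero entry of [x] at [s] the exponent [q] can be traded for [2], where the second
   difference is exactly quadratic. *)
have lower : dominated (fun a => 2 * coord w s ^+ 2 * a `^ 2)
    (fun a => second_diff p x (a *: z)).
  apply: (@dominated_trans _
      (fun a => second_diff 2 (coord x s : R^o) (a *: (coord w s : R^o)))).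
    apply: le_dominated => a a0; rewrite second_diff2 powR_mulrn ?(ltW a0)//.
    by rewrite exprMn; lra.
  apply: (@dominated_trans _
      (fun a => second_diff q (coord x s : R^o) (a *: (coord w s : R^o)))).
    by apply: second_diff_dominated => //; rewrite ltr1n.
  apply: (@dominated_trans _ (fun a => second_diff p x (a *: w))).
    exact: dominated_coord.
  by apply: le_dominated => a _; exact: contractive_second_diff.
(* The order is [p] if [x] vanishes on the whole row of [t], and [q] if only the entry at [t] is
   known to be zero. *)
have [r r2 upper] : exists2 r, 2 < r &
    dominated (fun a => second_diff p x (a *: z)) (fun a => a `^ r).
  have [xt0|xt0] := eqVneq (x t.1) 0.
    by exists p => //; exact: dominated_restrict1_row0.
  exists q => //; apply: dominated_trans (dominated_restrict1 y p_gt1 q_gt1 xt0) _.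
  apply: (@dominated_powR _ _ (2 * `|coord y t| `^ q)).
    by rewrite mulr_ge0// powR_ge0.
  by move=> a a0; rewrite xt second_diff0lZ// ltW.
have w2 : 0 <= 2 * coord w s ^+ 2 by rewrite mulr_ge0// sqr_ge0.
have /eqP := dominated_powR_eq0 r2 w2 (dominated_trans lower upper).
by rewrite mulf_eq0 pnatr_eq0/= sqrf_eq0 => /eqP.
Qed.

Lemma support_image1 x y t s : 1 < p < 2 -> 1 < q < 2 -> P x = x ->
  coord x t != 0 -> coord x s = 0 -> coord (P (restrict [set t] y)) s = 0.
Proof.
move=> /andP[p_gt1 p2] /andP[q_gt1 q2] Px xt xs; set z := restrict _ _; set w := P z.
have xt0 : x t.1 != 0.
  by apply: contra_neq xt => xt; rewrite /coord xt ell0.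
have upper : dominated (fun a => second_diff p x (a *: w)) (fun a => a `^ 2).
  apply: (@dominated_trans _ (fun a => second_diff p x (a *: z))).
    by apply: le_dominated => a _; exact: contractive_second_diff.
  apply: dominated_trans (dominated_restrict1 y p_gt1 q_gt1 xt0) _.
  apply: (@dominated_trans _
      (fun a => second_diff 2 (coord x t : R^o) (a *: (coord y t : R^o)))).
    by apply: second_diff_dominated => //; rewrite ltr1n.
  apply: (@dominated_powR _ _ (2 * coord y t ^+ 2)).
    by rewrite mulr_ge0// sqr_ge0.
  move=> a a0; rewrite second_diff2 powR_mulrn ?(ltW a0)//.
  by rewrite exprMn; lra.
(* If [x] vanishes on the whole row of [s], that row of [w] contributes at order [a^p]; otherwise
   its entry at [s] contributes at order [a^q]. As [p] and [q] are below [2], the coefficient must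
   vanish in either case. *)
have [xs0|xs0] := eqVneq (x s.1) 0.
  have c0 : 0 <= 2 * `|w s.1| `^ p by rewrite mulr_ge0// powR_ge0.
  have /(dominated_powR_eq0 p2 c0)/eqP :
      dominated (fun a => 2 * `|w s.1| `^ p * a `^ p) (fun a => a `^ 2).
    apply: dominated_trans upper; apply: le_dominated => a a0.
    by rewrite -second_diff0lZ ?(ltW a0)// -xs0; exact: second_diff_row_le.
  rewrite mulf_eq0 pnatr_eq0/= => /eqP/powR_eq0_eq0/normr0_eq0 ws.
  by rewrite /coord ws ell0.
have c0 : 0 <= 2 * `|coord w s| `^ q by rewrite mulr_ge0// powR_ge0.
have /(dominated_powR_eq0 q2 c0)/eqP :
    dominated (fun a => 2 * `|coord w s| `^ q * a `^ q) (fun a => a `^ 2).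
  apply: dominated_trans upper.
  apply: dominated_trans (dominated_coord w p_gt1 q_gt1 xs0).
  apply: le_dominated => a a0.
  by rewrite -(second_diff0lZ (coord w s : R^o)) ?(ltW a0)// xs.
by rewrite mulf_eq0 pnatr_eq0/= => /eqP/powR_eq0_eq0/normr0_eq0.
Qed.

Lemma contractive_closed : closed_subspace (range P).
Proof.
have [PP Pc] := Pproj; split=> [a _ _ [x _ <-] [y _ <-]|z zP].
  by exists (a *: x + y) => //; rewrite linearP.
exists z => //; apply/eqP; rewrite -subr_eq0 -normr_le0.
apply/ler_addgt0Pr => e e0; rewrite add0r.
have e20 : 0 < e / 2 by rewrite divr_gt0.
have [_ [z' _ <-] zz'] := zP _ e20.
(* [P] fixes [P z'], so both terms on the right have norm at most [e / 2]. *)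
have -> : P z - z = P (z - P z') - (z - P z').
  by rewrite linearB PP opprB addrA subrK.
rewrite (splitr e); apply: le_trans (ler_normB _ _) _.
by apply: lerD; [exact: le_trans (Pc _) zz'|exact: zz'].
Qed.

(** With [closed_subspace_restrict], this extends the results on single coordinates to restrictions
    to arbitrary sets. *)
Lemma closed_vanishing (S : set (nat * nat)) :
  closed_subspace [set z | forall s, S s -> coord (P z) s = 0].
Proof.
have [PP Pc] := Pproj; split=> [a x y Sx Sy s Ss|z zP s Ss].
  by rewrite linearP coordD coordZ Sx// Sy// mulr0 addr0.
apply/eqP; rewrite -normr_le0; apply/ler_addgt0Pr => e /zP[z' Sz' zz'].
rewrite add0r; apply: le_trans zz'; apply: le_trans (Pc _).
apply: le_trans (coord_le_norm _ s).
by rewrite linearB coordB (Sz' _ Ss) subr0.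
Qed.

(** The entries of [x] on [A] already account for the norm of [restrict A y], so strict monotonicity
    leaves no nonzero entry off [A]. *)
Lemma restrict_minimal A x y : (forall t, A t -> coord x t = coord y t) ->
  `|x| <= `|restrict A y| -> x = restrict A y.
Proof.
move=> xy le_x.
have le_c t : `|coord (restrict A y) t| <= `|coord x t|.
  rewrite coord_restrict; case: ifP => [/set_mem/xy->//|_].
  by rewrite normr0.
have eq_c := coord_norm_eq le_c le_x.
apply: coord_eqP => t; have := eq_c t; rewrite coord_restrict.
case: ifP => [/set_mem/xy->//|_]; rewrite normr0 => /esym/eqP.
by rewrite normr_eq0 => /eqP.
Qed.

Lemma restrict_support_range x y : (2 < p /\ 2 < q) \/ (1 < p < 2 /\ 1 < q < 2) ->
  range P x -> range P y -> range P (restrict (support x) y).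
Proof.
move=> pq rx ry; have [PP Pc] := Pproj.
have Px : P x = x by case: rx => x' _ <-.
have Py : P y = y by case: ry => y' _ <-.
set S := support x.
have yE : y = P (restrict S y) + P (restrict (~` S) y).
  by rewrite -linearD restrict_sum_setC Py.
case: pq => [[p2 q2]|[p12 q12]].
  (* Hence [P (restrict S y)] agrees with [y] on [S], and minimality identifies it with
     [restrict S y]. *)
  have H : forall s, S s -> coord (P (restrict (~` S) y)) s = 0.
    apply: (closed_subspace_restrict (closed_vanishing S)).
      by move=> s _; rewrite linear0 coord0.
    move=> t /= /negP/negPn/eqP xt s xs; exact: disjoint_image1 xt xs.
  exists (restrict S y); first exact: I.
  apply: restrict_minimal (Pc _) => t St.
  by rewrite [in RHS]yE coordD (H t St) addr0.
have H : forall s, (~` S) s -> coord (P (restrict S y)) s = 0.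
  apply: (closed_subspace_restrict (closed_vanishing (~` S))).
    by move=> s _; rewrite linear0 coord0.
  move=> t /= xt s /negP/negPn/eqP xs; exact: support_image1 xt xs.
have yS : P (restrict (~` S) y) = restrict (~` S) y.
  apply: restrict_minimal (Pc _) => t St.
  by rewrite [in RHS]yE coordD (H t St) add0r.
exists (restrict S y); first exact: I.
by apply: (addIr (restrict (~` S) y)); rewrite restrict_sum_setC -[in LHS]yS -yE.
Qed.

End contractive.

(** * Block bases of closed subspaces stable under restriction to supports *)

Section block_basis.
Context {R : realType} {p q : R} {p1 : 1 <= p} {q1 : 1 <= q}.
Notation X := (ell R^o q1).
Notation Z := (ell X p1).
Implicit Types (x y z : Z) (s t : nat * nat).

(** Each entry of [y - z n] is zero or that of [y], so for large [n] the difference is dominated by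
    [y] off a finite set. *)
Lemma cvg_coord (z : nat -> Z) y :
  (forall n t, coord (z n) t = 0 \/ coord (z n) t = coord y t) ->
  (forall t, exists N, forall n, (N <= n)%N -> coord (z n) t = coord y t) ->
  z @ \oo --> y.
Proof.
move=> z01 zy; apply/cvgrPdist_le => e /(restrict_setC_finite y)[l le].
have [N HN] : exists N, forall n, (N <= n)%N -> forall t, t \in l -> coord (z n) t = coord y t.
  elim: l {le} => [|t l [N HN]]; first by exists 0%N.
  have [M HM] := zy t; exists (maxn M N) => n; rewrite geq_max => /andP[Mn Nn] s.
  by rewrite in_cons => /predU1P[->|]; [exact: HM|exact: HN].
exists N; first exact: I.
move=> n Nn; apply: le_trans le; apply: coord_norm_le => t.
rewrite coordB coord_restrict; case: ifPn => [_|].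
  by case: (z01 n t) => ->; rewrite ?subr0 ?subrr ?normr0.
rewrite in_setC mem_setE negbK => tl.
by rewrite (HN n Nn t tl) subrr.
Qed.

Lemma coord_series (a : nat -> R) (e : nat -> Z) n t i :
  (forall j, j != i -> a j * coord (e j) t = 0) ->
  coord (series (fun i => a i *: e i) n) t =
  if (i < n)%N then a i * coord (e i) t else 0.
Proof.
move=> H; rewrite /series/= coord_sum.
under eq_bigr do rewrite coordZ.
have [ilt|ni] := ltnP i n.
  rewrite (bigD1_seq i) ?mem_index_iota ?iota_uniq//= big1 ?addr0 => [//|j ji].
  by rewrite H.
rewrite big_seq big1// => j; rewrite mem_index_iota => /andP[_ jn].
by apply: H; rewrite ltn_eqF// (leq_trans jn).
Qed.

Lemma set_bij_basis_index (T : pointedType) (M : set T) : countable M ->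
  exists d (f : nat -> T), set_bij (basis_index d) M f.
Proof.
move=> cM; have [/finite_setP[n]|fM] := pselect (finite_set M).
  by rewrite card_eq_sym => /card_set_bijP[f fb]; exists (Some n), f.
have := eq_card_nat cM fM.
by rewrite card_eq_sym => /card_set_bijP[f fb]; exists None, f.
Qed.

Context (Y : set Z) (cY : closed_subspace Y).
Context (stY : forall x y, Y x -> Y y -> Y (restrict (support x) y)).

(** The intersection of all supports of elements of [Y] that contain [t]; for active [t] it is the
    minimal support around [t]. *)
Definition cell t : set (nat * nat) :=
  [set s | forall y, Y y -> coord y t != 0 -> coord y s != 0].

Definition active : set (nat * nat) := [set t | exists2 y, Y y & coord y t != 0].

Lemma restrict_cell t x : Y x -> Y (restrict (cell t) x).
Proof.
move=> Yx.
(* Finitely many supports suffice to exclude the points of [l] outside the cell; closedness of [Y]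
   then handles the infinite intersection. *)
have HA (l : seq (nat * nat)) : exists A, [/\ cell t `<=` A,
    Y (restrict A x) & A `&` [set` l] `<=` cell t].
  elim: l => [|s l [A [tA YA Al]]].
    exists setT; split=> //; last by move=> s [].
    rewrite (_ : restrict _ x = x)//.
    by apply: coord_eqP => s; rewrite coord_restrict in_setT.
  have [ts|/existsNP[y /not_implyP[Yy /not_implyP[yt /negP/negPn/eqP ys]]]] :=
      pselect (cell t s).
    exists A; split=> // r [Ar]/=; rewrite in_cons => /predU1P[->//|rl].
    exact: Al.
  exists (support y `&` A); split=> [r tr||r [[yr Ar]]/=].
  - by split; [exact: (tr y)|exact: tA].
  - by rewrite -restrict_restrict; exact: stY.
  - rewrite in_cons => /predU1P[rs|rl]; last exact: Al.
    by move: yr; rewrite /support/= rs ys eqxx.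
case: (cY) => _; apply => e /(restrict_setC_finite x)[l le].
have [A [tA YA Al]] := HA l; exists (restrict A x); first exact: YA.
apply: le_trans le; apply: coord_norm_le => s.
rewrite coordB !coord_restrict in_setC mem_setE.
have [sl|sl] := boolP (s \in l).
  rewrite (_ : (s \in A) = (s \in cell t)) ?subrr ?normr0//.
  apply/idP/idP => /set_mem sA; apply/mem_set; last exact: tA.
  exact: Al.
have [st|st] := boolP (s \in cell t); have [sA|sA] := boolP (s \in A);
  rewrite /= ?subrr ?subr0 ?sub0r ?normrN ?normr0 ?normr_ge0 ?lexx//.
Qed.

(* Otherwise removing the support of [restrict (cell t) u] from a vector not
   vanishing at [t] would shrink the cell of [t]. *)
Lemma restrict_cell_eq0 t u : active t -> Y u -> coord u t = 0 ->
  restrict (cell t) u = 0.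
Proof.
move=> [x Yx xt] Yu ut; set v := restrict _ u.
have Yv : Y v by exact: restrict_cell.
have vt : coord v t = 0 by rewrite coord_restrict ut; case: ifP.
apply: coord_eqP => s; rewrite coord0; apply/eqP/negPn/negP => vs.
have ts : cell t s.
  by move: vs; rewrite coord_restrict; case: ifP => [/set_mem//|]; rewrite eqxx.
have /ts : Y (x - restrict (support v) x) by apply: closed_subspaceB => //; exact: stY.
have -> : coord (x - restrict (support v) x) s = 0.
  by rewrite coordB coord_restrict mem_set ?subrr.
rewrite coordB coord_restrict memNset ?subr0 => [|]; last by rewrite /support/= vt eqxx.
by move=> /(_ xt); rewrite eqxx.
Qed.

Lemma cell_refl t : cell t t. Proof. by []. Qed.

Lemma cell_active t s : active t -> cell t s -> active s.
Proof. by move=> [y Yy yt] ts; exists y => //; exact: ts. Qed.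

(** Membership is symmetric, because an element of [Y] vanishing at [t] vanishes on the whole cell
    of [t]. Thus cells partition the active coordinates. *)
Lemma cell_eq t s : active t -> cell t s -> cell s = cell t.
Proof.
move=> It ts; have st : cell s t.
  move=> y Yy; apply: contra => /eqP yt.
  have := congr1 (fun z => coord z s) (restrict_cell_eq0 It Yy yt).
  by rewrite coord_restrict coord0 (mem_set ts) => ->.
apply/seteqP; split=> r H y Yy yn.
- by apply: H => //; exact: ts.
- by apply: H => //; exact: st.
Qed.

(** Spans the line of restrictions of [Y] to the cell of [t], with the entry at [t] normalised; the
    default [0] is taken when [t] is not active. *)
Definition cell_vec t : Z :=
  xget 0 [set x | [/\ Y x, coord x t = 1 & forall s, ~ cell t s -> coord x s = 0]].

Lemma cell_vecP t : active t -> [/\ Y (cell_vec t), coord (cell_vec t) t = 1 &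
  forall s, ~ cell t s -> coord (cell_vec t) s = 0].
Proof.
move=> [x Yx xt]; apply: (@xgetPex _ 0
  [set x | [/\ Y x, coord x t = 1 & forall s, ~ cell t s -> coord x s = 0]]).
exists (restrict (cell t) ((coord x t)^-1 *: x)); split.
- by apply: restrict_cell; exact: closed_subspaceZ.
- by rewrite coord_restrict (mem_set (@cell_refl t)) coordZ mulVf.
- by move=> s ts; rewrite coord_restrict memNset.
Qed.

(** Subtracting [coord y t *: cell_vec t] from [y] kills the entry at [t], hence all entries in the
    cell. *)
Lemma coord_cell_vec t s y : active t -> Y y -> cell t s ->
  coord y s = coord y t * coord (cell_vec t) s.
Proof.
move=> It Yy ts; have [Yb bt _] := cell_vecP It.
have Yu : Y (y - coord y t *: cell_vec t).
  by apply: closed_subspaceB => //; exact: closed_subspaceZ.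
have ut : coord (y - coord y t *: cell_vec t) t = 0.
  by rewrite coordB coordZ bt mulr1 subrr.
have := congr1 (fun z => coord z s) (restrict_cell_eq0 It Yu ut).
by rewrite coord_restrict coord0 (mem_set ts) coordB coordZ => /eqP; rewrite subr_eq0 => /eqP.
Qed.

(** [get] depends only on the set, so all points of the cell of an active coordinate yield the same
    representative. *)
Definition cell_repr t : nat * nat := get (cell t).

Lemma cell_reprP t : cell t (cell_repr t).
Proof. by apply: (@getPex _ (cell t)); exists t; exact: cell_refl. Qed.

Lemma cell_repr_eq s t r : active s -> active t -> cell s r -> cell t r ->
  cell_repr s = cell_repr t.
Proof.
by move=> Is It sr tr; rewrite /cell_repr -(cell_eq Is sr) (cell_eq It tr).
Qed.

Lemma block_basis_closed_subspace : exists d e, block_basis Y d e.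
Proof.
(* One point per cell; enumerating these points indexes the basis. *)
pose M := cell_repr @` active.
have [d [f [fM f_inj f_surj]]] : exists d f, set_bij (basis_index d) M f.
  by apply: set_bij_basis_index; exact: countableP.
have fact i : basis_index d i -> active (f i) /\ cell_repr (f i) = f i.
  move=> /fM[t It <-]; have tt := @cell_reprP t; have It' := cell_active It tt.
  split=> //; apply: (@cell_repr_eq _ _ (cell_repr t)) => //.
have f_cell i j t : basis_index d i -> basis_index d j ->
    cell (f i) t -> cell (f j) t -> i = j.
  move=> di dj it jt; apply: f_inj; rewrite ?inE//.
  have [Ii <-] := fact _ di; have [Ij <-] := fact _ dj.
  exact: cell_repr_eq it jt.
pose e i := cell_vec (f i).
have e0 i t : basis_index d i -> ~ cell (f i) t -> coord (e i) t = 0.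
  by move=> /fact[Ii _]; case: (cell_vecP Ii) => _ _; apply.
have Ye i : basis_index d i -> Y (e i).
  by move=> /fact[Ii _]; case: (cell_vecP Ii).
exists d, e; split; last first.
  move=> i j di dj ij k; apply/seteqP; split=> // m /= [im jm].
  apply: (negP ij); apply/eqP; apply: (@f_cell _ _ (k, m)) => //.
    by apply: contrapT => /(e0 _ _ di)/eqP; apply/negP.
  by apply: contrapT => /(e0 _ _ dj)/eqP; apply/negP.
split=> // y Yy.
have single (a : nat -> R) t i : (forall j, ~ basis_index d j -> a j = 0) ->
    basis_index d i -> cell (f i) t -> forall j, j != i -> a j * coord (e j) t = 0.
  move=> a0 di it j ji; have [dj|/a0->] := pselect (basis_index d j); last by rewrite mul0r.
  rewrite e0 ?mulr0// => jt; apply: (negP ji); apply/eqP; exact: f_cell jt it.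
(* Each basis vector has entry [1] at its representative [f i], so the coefficient of [y] is read
   off there. *)
pose a i := if i \in basis_index d then coord y (f i) else 0.
have a0 i : ~ basis_index d i -> a i = 0 by move=> di; rewrite /a memNset.
exists a; split.
  split=> //.
  (* At an active [t] only the vector of its cell contributes, so the partial sums jump once from
     [0] to their final value; at other points everything is zero. *)
  have a_coord t : (forall n, coord (series (fun i => a i *: e i) n) t = coord y t) \/
      exists i, forall n, coord (series (fun i => a i *: e i) n) t =
        if (i < n)%N then coord y t else 0.
    have [It|nIt] := pselect (active t).
      right; have /f_surj[i di fi] : M (cell_repr t) by exists t.
      have it : cell (f i) t.
        by rewrite fi (cell_eq It (@cell_reprP t)); exact: cell_refl.
      exists i => n; rewrite (@coord_series _ _ _ _ _ (single a t i a0 di it)).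
      have [Ii _] := fact i di.
      by rewrite (coord_cell_vec Ii Yy it) /a (mem_set di).
    have Y0 z : Y z -> coord z t = 0.
      by move=> Yz; apply/eqP/negPn/negP => zt; apply: nIt; exists z.
    left=> n; rewrite (Y0 _ Yy) /series/= coord_sum big1// => j _; rewrite coordZ.
    by have [/Ye/Y0->|/a0->] := pselect (basis_index d j); rewrite ?mulr0 ?mul0r.
  apply: cvg_coord => [n t|t].
    have [->|[i ->]] := a_coord t; first by right.
    by case: ifP; [right|left].
  have [at_const|[i ai]] := a_coord t; first by exists 0%N => n _; exact: at_const.
  by exists i.+1 => n ilt; rewrite ai ilt.
move=> b [b0 /cvgrPdist_le bY]; apply/funext => i.
have [di|di] := pselect (basis_index d i); last by rewrite a0// b0.
rewrite /a (mem_set di); apply/eqP; rewrite -subr_eq0 -normr_le0.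
apply/ler_addgt0Pr => r /bY[N _ HN]; rewrite add0r.
(* Once [i.+1] terms are summed, the entry at [f i] equals [b i], which forces uniqueness. *)
have := HN (maxn N i.+1) (leq_maxl _ _); apply: le_trans.
apply: le_trans (coord_le_norm _ (f i)).
rewrite coordB (@coord_series _ _ _ _ _ (single b _ i b0 di (@cell_refl _))) leq_maxr.
have [Ii _] := fact i di; have [_ -> _] := cell_vecP Ii.
by rewrite mulr1.
Qed.

End block_basis.

Theorem corollary4p4 (R : realType) (p q : R) (p1 : 1 <= p) (q1 : 1 <= q)
    (pq : (2 < p /\ 2 < q) \/ (1 < p < 2 /\ 1 < q < 2))
    (P : {linear ell (ell R^o q1) p1 -> ell (ell R^o q1) p1})
    (Pproj : contractive_projection P) :
  exists (d : option nat) (e : nat -> ell (ell R^o q1) p1),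
    block_basis (range P) d e.
Proof.
apply: block_basis_closed_subspace.
  exact: contractive_closed Pproj.
by move=> x y; exact: restrict_support_range.
Qed.
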